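(* For all integers $r,z,k\ge 1$ there exists a mixed geodetic $(r,z,k)$-cage.
   Context: A (finite) mixed graph $G$ consists of a vertex set $V(G)$, a set of undirected edges and a set of directed arcs (ordered pairs of vertices). Loops are forbidden, as are parallel edges and arcs. Write $u\sim v$ if there is an edge between $u$ and $v$, and $u\to v$ if there is an arc from $u$ to $v$. The undirected degree of $u$ is the number of edges incident with $u$; the directed out-degree of $u$ is the number of arcs with initial vertex $u$. A walk of length $\ell$ from $u_0$ to $u_\ell$ is a sequence $u_0u_1\dots u_\ell$ of vertices such that for each $0\le i\le \ell-1$ either $u_i\sim u_{i+1}$ or $u_i\to u_{i+1}$. A mixed path is a non-backtracking walk, i.e. a walk that never traverses an edge and then immediately retraces it (no $u_i\sim u_{i+1}\sim u_i$); walks of length $0$ are allowed. $G$ is $k$-geodetic if for every ordered pair $(u,v)$ of (not necessarily distinct) vertices there is at most one mixed path from $u$ to $v$ of length $\le k$. A (mixed geodetic) $(r,z,k)$-cage is a mixed graph of smallest possible order among all $k$-geodetic mixed graphs with minimum undirected degree $r$ and minimum directed out-degree $z$ (equivalently, of smallest possible excess, the excess being the order minus the mixed Moore bound $M(r,z,k)$, a constant depending only on $r,z,k$). Thus the existence of a cage amounts to the existence of at least one finite $k$-geodetic mixed graph with these minimum degrees. *)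

(* Defs.v *)
From mathcomp Require Import all_boot.

Set Implicit Arguments.
Unset Strict Implicit.
Unset Printing Implicit Defensive.

(* [edge_arc_disjoint], with the symmetry of [edge], forbids an edge parallel
   to an arc in either direction; parallel edges and parallel arcs are excluded
   by the use of relations. Opposite arcs u -> v and v -> u are not parallel. *)
Record mixedGraph := MixedGraph {
  vertex :> finType;
  edge : rel vertex;
  arc : rel vertex;
  edge_sym : symmetric edge;
  edge_irr : irreflexive edge;
  arc_irr : irreflexive arc;
  edge_arc_disjoint : forall u v, ~~ (edge u v && arc u v)
}.

Section MixedGraphTheory.

Variable G : mixedGraph.

Definition udeg (u : G) : nat := #|[set v | edge u v]|.

Definition outdeg (u : G) : nat := #|[set v | arc u v]|.

(* In particular, G is nonempty. *)
Definition min_degree_is (deg : G -> nat) (d : nat) : Prop :=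
  (forall u, d <= deg u) /\ (exists u, deg u = d).

Definition step : rel G := [rel u v | edge u v || arc u v].

Fixpoint nonbacktracking (s : seq G) : bool :=
  if s is x :: ((y :: z :: _) as s') then
    ~~ [&& edge x y, edge y z & z == x] && nonbacktracking s'
  else true.

(* The walk is u :: p, so that its length is [size p]. *)
Definition mixed_path (u v : G) (p : seq G) : bool :=
  [&& path step u p, last u p == v & nonbacktracking (u :: p)].

Definition geodetic (k : nat) : Prop :=
  forall (u v : G) (p q : seq G),
    mixed_path u v p -> mixed_path u v q ->
    size p <= k -> size q <= k -> p = q.

Definition cage_candidate (r z k : nat) : Prop :=
  [/\ geodetic k, min_degree_is udeg r & min_degree_is outdeg z].

End MixedGraphTheory.

Definition is_cage (r z k : nat) (G : mixedGraph) : Prop :=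
  cage_candidate G r z k /\
  (forall H : mixedGraph, cage_candidate H r z k -> #|G| <= #|H|).

(* Main.v *)
Require Import Defs.
From mathcomp Require Import all_boot all_fingroup.
From Stdlib Require Import Classical.

Set Implicit Arguments.
Unset Strict Implicit.
Unset Printing Implicit Defensive.

Import GroupScope.

(** A cage exists as soon as some candidate does, since orders are natural
    numbers; so everything lies in producing one finite [k]-geodetic mixed graph
    of constant undirected degree [r] and constant out-degree [z].

    The infinite model is the Cayley graph of the free product of [r] copies of
    Z/2 (the edges) and [z] copies of Z (the arcs).  Arcs are followed forwards
    only, so a mixed path from a given vertex is there the same thing as a
    reduced word in the generators themselves, without inverses: one in which no
    edge letter is immediately repeated.  Distinct reduced words lead to
    distinct elements.  A finite group with such generators does the same job,
    provided that its products still separate the reduced words of length at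
    most [k] ([cayley_graph_candidate]); involutivity of the edge generators makes the
    edge relation symmetric and turns a repeated edge letter into a backtrack.

    The symmetric group of the finite set of words of length at most [k] is
    such a group; the generators need not generate all of it, in which case the
    Cayley graph is merely disconnected.  The letter [l] should send [s] to
    [l :: s].  For an arc letter this is an injection on the words of length
    less than [k], hence extends to a permutation
    ([partial_injection_extends]); for an edge letter the pairs
    [{s, l :: s}], with [s] not starting with [l], are disjoint and can be
    swapped ([toggleK]).  Applied to the empty word, the product along a reduced
    word [w] writes [w] itself, so that [w] can be read off from the group
    element ([word_prod_nil]). *)

Section ReducedWords.

Variables I J : finType.

Definition edge_letter (l : I + J) : bool := if l is inl _ then true else false.

Definition compatible (l l' : I + J) : bool := ~~ (edge_letter l && (l == l')).

Definition reduced (w : seq (I + J)) : bool := sorted compatible w.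

(** * Cayley graphs as mixed graphs *)

Section Cayley.

Variables (gT : finGroupType) (gen : I + J -> gT).

(** The factors are in reverse order because generators act on the left:
    following the letters of [w] in turn leads from [u] to [word_prod w * u]. *)
Fixpoint word_prod (w : seq (I + J)) : gT :=
  if w is l :: w' then word_prod w' * gen l else 1.

Definition word_walk (u : gT) (w : seq (I + J)) : seq gT :=
  scanl (fun g l => gen l * g) u w.

Lemma last_word_walk u w : last u (word_walk u w) = word_prod w * u.
Proof.
by elim: w u => [|l w IHw] u /=; rewrite ?mul1g // IHw mulgA.
Qed.

Hypothesis gen_invol : forall i, gen (inl i) * gen (inl i) = 1.

Variable k : nat.
Hypothesis k_gt0 : 0 < k.
Hypothesis word_prod_inj : forall v w,
  reduced v -> reduced w -> size v <= k -> size w <= k ->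
  word_prod v = word_prod w -> v = w.

(** Words of one letter are always reduced, so their separation makes the
    degrees as large as the number of generators and keeps edges and arcs
    apart. *)
Lemma gen_inj : injective gen.
Proof.
move=> l l' eq_gen.
have := @word_prod_inj [:: l] [:: l'] isT isT k_gt0 k_gt0.
by rewrite /= eq_gen => /(_ erefl)[].
Qed.

Lemma gen_neq1 l : gen l != 1.
Proof.
apply/eqP=> gen1.
have := @word_prod_inj [:: l] [::] isT isT k_gt0 isT.
by rewrite /= gen1 mul1g => /(_ erefl).
Qed.

Definition cayley_edge : rel gT :=
  [rel u v | v * u^-1 \in codom (fun i => gen (inl i))].

Definition cayley_arc : rel gT :=
  [rel u v | v * u^-1 \in codom (fun j => gen (inr j))].

Lemma cayley_edgeP u v :
  reflect (exists i, v = gen (inl i) * u) (cayley_edge u v).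
Proof.
apply: (iffP codomP) => [] [i e]; exists i; first by rewrite -e mulgKV.
by rewrite e mulgK.
Qed.

Lemma cayley_arcP u v :
  reflect (exists j, v = gen (inr j) * u) (cayley_arc u v).
Proof.
apply: (iffP codomP) => [] [j e]; exists j; first by rewrite -e mulgKV.
by rewrite e mulgK.
Qed.

Lemma cayley_edge_sym : symmetric cayley_edge.
Proof.
have sub u v : cayley_edge u v -> cayley_edge v u.
  case/cayley_edgeP=> i ->; apply/cayley_edgeP; exists i.
  by rewrite mulgA gen_invol mul1g.
by move=> u v; apply/idP/idP; apply: sub.
Qed.

Lemma cayley_edge_irr : irreflexive cayley_edge.
Proof.
move=> u; apply/negP=> /codomP[i]; rewrite mulgV => /esym/eqP.
exact/negP/gen_neq1.
Qed.

Lemma cayley_arc_irr : irreflexive cayley_arc.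
Proof.
move=> u; apply/negP=> /codomP[j]; rewrite mulgV => /esym/eqP.
exact/negP/gen_neq1.
Qed.

Lemma cayley_edge_arc_disjoint u v : ~~ (cayley_edge u v && cayley_arc u v).
Proof.
by apply/negP=> /andP[/codomP[i e] /codomP[j]]; rewrite e => /gen_inj.
Qed.

Definition cayley_graph : mixedGraph :=
  MixedGraph cayley_edge_sym cayley_edge_irr cayley_arc_irr
    cayley_edge_arc_disjoint.

Lemma card_translates (T : finType) (f : T -> gT) (u : gT) :
  injective f -> #|[set v | v * u^-1 \in codom f]| = #|T|.
Proof.
move=> f_inj; rewrite -(card_codom f_inj).
rewrite -(card_imset (mem (codom f)) (mulIg u)).
apply: eq_card => v; rewrite inE; apply/idP/imsetP => [fv|[x fx ->]].
  by exists (v * u^-1); rewrite ?mulgKV.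
by rewrite mulgK.
Qed.

(** The excluded backtrack is exactly a repeated edge letter: the letter [l]
    followed by itself returns to the starting vertex when [gen l] is an
    involution. *)
Lemma mixed_path_word (u : cayley_graph) (p : seq cayley_graph) :
  path (@step cayley_graph) u p -> nonbacktracking (u :: p) ->
  exists2 w, reduced w & p = word_walk u w.
Proof.
elim: p u => [|y p IHp] u; first by exists [::].
rewrite [path _ _ _]/= => /andP[uy yp] nb.
have nb_y : nonbacktracking (y :: p).
  by move: nb; case: (p) => // x s /= /andP[].
have [l def_y] : exists l, y = gen l * u.
  by case/orP: uy => [/cayley_edgeP[i ->]|/cayley_arcP[j ->]];
    [exists (inl i) | exists (inr j)].
have [w red_w def_p] := IHp y yp nb_y.
exists (l :: w); last by rewrite def_p def_y.
case: w red_w def_p => [//|l' w] red_w def_p.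
rewrite /reduced /=; apply/andP; split=> //.
apply/negP=> /andP[]; case: l def_y => // i def_y _ /eqP def_l'.
move: nb; rewrite def_p -def_l' /=.
have -> : gen (inl i) * y = u by rewrite def_y mulgA gen_invol mul1g.
have edge_uy : cayley_edge u y by apply/cayley_edgeP; exists i.
by rewrite edge_uy cayley_edge_sym edge_uy eqxx.
Qed.

Lemma cayley_graph_geodetic : geodetic cayley_graph k.
Proof.
move=> u v p q /and3P[up /eqP last_p nb_p] /and3P[uq /eqP last_q nb_q].
have [w red_w def_p] := mixed_path_word up nb_p.
have [w' red_w' def_q] := mixed_path_word uq nb_q.
move: last_p last_q; rewrite {}def_p {}def_q !last_word_walk !size_scanl.
move=> <- /mulIg eq_prod le_w le_w'.
by rewrite (word_prod_inj red_w red_w' le_w le_w').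
Qed.

Lemma cayley_graph_candidate : cage_candidate cayley_graph #|I| #|J| k.
Proof.
have udegE (u : cayley_graph) : udeg u = #|I|.
  by apply: card_translates => i i' /gen_inj[].
have outdegE (u : cayley_graph) : outdeg u = #|J|.
  by apply: card_translates => j j' /gen_inj[].
split; first exact: cayley_graph_geodetic.
  by split=> [u|]; [rewrite udegE | exists (1 : gT); rewrite udegE].
by split=> [u|]; [rewrite outdegE | exists (1 : gT); rewrite outdegE].
Qed.

End Cayley.

(** * Permutations of the words of bounded length *)

Variable k : nat.

Notation word := (k.-bseq (I + J)).

(** Pushing leaves the words of full length [k] in place. *)
Definition push (l : I + J) (s : word) : word := insubd s (l :: s).

Lemma val_push l (s : word) : size s < k -> val (push l s) = l :: s.
Proof. by move=> lt_s; rewrite val_insubd /= lt_s. Qed.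

(** Words starting with [l] twice belong to no pair [{s, l :: s}] with [s] not
    starting with [l]; they are fixed, like the words of length [k] to which [l]
    could only be added. *)
Definition toggle (l : I + J) (s : word) : word :=
  if ohead s != Some l then push l s
  else if ohead (behead s) != Some l then insubd s (behead s) else s.

Lemma toggleK l : involutive (toggle l).
Proof.
move=> s; rewrite {2}/toggle; case: ifPn => [s'l|].
  have [lt_s|le_s] := ltnP (size s) k; last first.
    have -> : push l s = s.
      by apply: val_inj; rewrite val_insubd /= ltnNge le_s.
    rewrite /toggle s'l.
    by apply: val_inj; rewrite val_insubd /= ltnNge le_s.
  rewrite /toggle val_push //= eqxx /= s'l.
  by apply: val_inj; rewrite val_insubd val_push //= size_bseq.
rewrite negbK => /eqP sl.
have def_s : s = l :: behead s :> seq _.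
  by case: (bseqval s) sl => //= x t [->].
case: ifPn => [s'l|sll]; last by rewrite /toggle sl eqxx /= (negPf sll).
have lt_s : size (behead s) < k.
  by have := size_bseq s; rewrite [in X in X -> _]def_s.
have val_s' : val (insubd s (behead s)) = behead s.
  by rewrite val_insubd (ltnW lt_s).
rewrite /toggle val_s' s'l; apply: val_inj.
by rewrite val_push val_s' // -def_s.
Qed.

Lemma partial_injection_extends (T : finType) (f : T -> T) (A : seq T) :
  {in A &, injective f} -> exists p : {perm T}, {in A, p =1 f}.
Proof.
elim: A => [|x A IHA] f_inj; first by exists 1.
have [y z Ay Az|p pE] := IHA.
  by apply: f_inj; rewrite inE ?Ay ?Az orbT.
have [Ax|A'x] := boolP (x \in A).
  by exists p => y; rewrite inE => /predU1P[->|]; [apply: pE | apply: pE].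
(* Composing with the transposition corrects the value at x; it moves no value
   f y with y in A, which is neither p x nor f x. *)
exists (p * tperm (p x) (f x)) => y.
rewrite inE permM => /predU1P[->|Ay]; first by rewrite tpermL.
have x'y : x != y by apply: contraNneq A'x => ->.
rewrite (pE y Ay) tpermD //; first by rewrite -(pE y Ay) (inj_eq perm_inj).
by apply: contra_neq x'y; apply: f_inj; rewrite inE ?eqxx ?Ay ?orbT.
Qed.

(** One permutation for each kind of letter: the swap [toggle], of order two,
    for an edge, and any extension of [push] for an arc. *)
Lemma word_permutations : exists gen : I + J -> {perm word},
  (forall i, gen (inl i) * gen (inl i) = 1) /\
  (forall l (s : word), size s < k -> reduced (l :: s) ->
     val (gen l s) = l :: s).
Proof.
have arc_perm j : exists p : {perm word},
    forall s : word, size s < k -> p s = push (inr j) s.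
  have [s t|p pE] := @partial_injection_extends _ (push (inr j))
      (enum [pred s : word | size s < k]).
    rewrite !mem_enum !inE => lt_s lt_t /(congr1 val).
    by rewrite !val_push // => -[] /val_inj.
  by exists p => s lt_s; rewrite pE // mem_enum.
have [arc_gen arc_genE] := fin_all_exists arc_perm.
exists (fun l => match l with
  | inl i => perm (can_inj (toggleK (inl i)))
  | inr j => arc_gen j end).
split=> [i|]; first by apply/permP=> s; rewrite permM !permE toggleK.
case=> [i|j] s lt_s red_s; last by rewrite arc_genE ?val_push.
rewrite permE /toggle ifT ?val_push //.
move: red_s; rewrite /reduced /=; case: (bseqval s) => //= x t /andP[].
by rewrite /compatible /= eq_sym.
Qed.

(** The rightmost factor of a product of permutations acts last; in
    [word_prod w] it comes from the first letter of [w], so that the word is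
    built up from its end. *)
Lemma word_prod_nil (gen : I + J -> {perm word}) :
  (forall l (s : word), size s < k -> reduced (l :: s) ->
     val (gen l s) = l :: s) ->
  forall w, reduced w -> size w <= k ->
    val (word_prod gen w [bseq]) = w.
Proof.
move=> genE; elim=> [|l w IHw] red_w le_w; first by rewrite perm1.
have val_w := IHw (path_sorted red_w) (ltnW le_w).
by rewrite permM genE val_w.
Qed.

Lemma ex_cage_candidate :
  0 < k -> exists G : mixedGraph, cage_candidate G #|I| #|J| k.
Proof.
move=> k_gt0; have [gen [gen_invol genE]] := word_permutations.
have gen_sep v w : reduced v -> reduced w -> size v <= k -> size w <= k ->
    word_prod gen v = word_prod gen w -> v = w.
  move=> red_v red_w le_v le_w eq_prod.
  by rewrite -(word_prod_nil genE red_v le_v) eq_prod word_prod_nil.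
by eexists; exact: (cayley_graph_candidate gen_invol k_gt0 gen_sep).
Qed.

End ReducedWords.

(** * Existence of cages *)

Lemma ex_cage_of_candidate r z k (G : mixedGraph) :
  cage_candidate G r z k -> exists H : mixedGraph, is_cage r z k H.
Proof.
have [n le_G] := ubnP #|G|; elim: n => // n IHn in G le_G * => candG.
have [[H [candH lt_HG]]|min_G] := classic (exists H : mixedGraph,
    cage_candidate H r z k /\ #|H| < #|G|).
  exact: (IHn H (leq_trans lt_HG le_G)).
exists G; split=> // H candH; rewrite leqNgt; apply/negP=> lt_HG.
by apply: min_G; exists H.
Qed.

Theorem theorem8 (r z k : nat) (hr : 1 <= r) (hz : 1 <= z) (hk : 1 <= k) :
  exists G : mixedGraph, is_cage r z k G.
Proof.
have [G] := ex_cage_candidate 'I_r 'I_z hk.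
by rewrite !card_ord => /ex_cage_of_candidate.
Qed.
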